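(* Let $(S,\rho)$ be a strict Robinson space with $S=\{1,2,\dots,n\}$, $n\ge 2$, for which the identity order $1<2<\cdots<n$ is compatible. Then $(S,\rho)$ admits a valid drawing in a caterpillar if and only if the following system is infeasible, i.e. there is no vector $\mathbf{y_N}\in\mathbb{R}^{(n-1)(n-2)}$ with $$\mathbf{Y_S}\,\mathbf{y_N}\ge 0,\qquad \mathbf{y_N}\ge 0,\qquad \mathbf{y_N}\ne 0,$$ where inequalities between vectors are componentwise.
   Context: A dissimilarity on a finite set $S$ is a function $\rho:S\times S\to\mathbb{R}_{\ge 0}$ with $\rho(x,y)=\rho(y,x)$ for all $x,y$, and $\rho(x,y)=0$ if and only if $x=y$; $(S,\rho)$ is then a dissimilarity space. It is Robinson if there is a total order $<$ on $S$ (a compatible order) such that $\rho(x,z)\ge\max\{\rho(x,y),\rho(y,z)\}$ for all $x<y<z$. It is strict if $\rho(x,y)\ne\rho(u,v)$ for any two distinct unordered pairs $\{x,y\}\ne\{u,v\}$ that are not both on the diagonal (i.e. $x\ne y$ or $u\neq v$). Centers: for $i<k$, $L(i,k)=\max\{j\in[i,k]:\rho(i,j)<\rho(j,k)\}$ and $R(k,i)=\min\{j\in[i,k]:\rho(i,j)>\rho(j,k)\}$, where $[i,k]=\{i,i+1,\dots,k\}$. Matrix $\mathbf{Y_S}$: consider real variables $h_2,\dots,h_n,l_2,\dots,l_n$ and put $h_1=l_1=0$. Let $\mathbf{A_S}$ be the $n(n-1)\times(2n-2)$ matrix whose columns are indexed by these variables and whose rows are indexed by the ordered pairs of distinct elements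 of $\{1,\dots,n\}$; for $i<j$, row $(i,j)$ is the coefficient vector of the linear form $h_i+h_j-2h_{L(i,j)}-l_i+l_j$, and row $(j,i)$ is the coefficient vector of the linear form $-h_i-h_j+2h_{R(j,i)}+l_i-l_j$. Let $\mathbf{B_S}$ be the square submatrix formed by the rows indexed by consecutive pairs, in the order $(1,2),\dots,(n-1,n),(2,1),\dots,(n,n-1)$, and $\mathbf{N_S}$ the submatrix formed by the remaining $(n-1)(n-2)$ rows, indexed by pairs with $|i-j|>1$. The matrix $\mathbf{B_S}$ is invertible, and $\mathbf{Y_S}:=-(\mathbf{B_S}^\top)^{-1}\mathbf{N_S}^\top$. A valid drawing of $(S,\rho)$ in a metric space $(\mathcal{X},d)$ is an injection $I:S\to\mathcal{X}$ such that for all $x,y,z\in S$ with $\rho(x,y)<\rho(x,z)$ one has $d(I(x),I(y))<d(I(x),I(z))$. A caterpillar graph is a finite tree such that deleting all its leaves leaves a path (possibly empty or a single vertex). A caterpillar is a caterpillar graph with positive edge lengths, viewed as a metric space on its vertex set with the weighted path metric. *)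

(* Defs.v *)
From mathcomp Require Import all_boot all_order all_algebra.
From mathcomp Require Import reals.

Set Implicit Arguments.
Unset Strict Implicit.
Unset Printing Implicit Defensive.

Import Order.TTheory GRing.Theory Num.Theory.
Local Open Scope ring_scope.

Section Dissimilarity.
Variables (R : realType) (S : finType).
Implicit Types (rho : S -> S -> R) (lt : rel S).

Definition dissimilarity rho : Prop :=
  [/\ forall x y, 0 <= rho x y,
      forall x y, rho x y = rho y x
    & forall x y, rho x y = 0 <-> x = y].

Definition strict_total_order lt : Prop :=
  [/\ irreflexive lt, transitive lt
    & forall x y, x != y -> lt x y || lt y x].

Definition compatible_order rho lt : Prop :=
  strict_total_order lt /\
  forall x y z, lt x y -> lt y z ->
    Num.max (rho x y) (rho y z) <= rho x z.

Definition robinson rho : Prop := exists lt, compatible_order rho lt.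

Definition strict_dissimilarity rho : Prop :=
  forall x y u v, [set x; y] != [set u; v] -> x <> y \/ u <> v ->
    rho x y <> rho u v.

Definition strict_robinson_space rho : Prop :=
  [/\ dissimilarity rho, robinson rho & strict_dissimilarity rho].

Definition valid_drawing rho (X : Type) (d : X -> X -> R) (I : S -> X) : Prop :=
  injective I /\
  forall x y z, rho x y < rho x z -> d (I x) (I y) < d (I x) (I z).

End Dissimilarity.

Section Caterpillar.
Variables (R : realType) (V : finType).
Implicit Types (e : rel V) (w d : V -> V -> R).

Definition simple_graph e : Prop := symmetric e /\ irreflexive e.

Definition tree e : Prop :=
  [/\ simple_graph e, (0 < #|V|)%N, forall x y, connect e x y
    & forall c : seq V, ucycle e c -> (size c <= 2)%N].

Definition leaves e : {set V} := [set x | #|[set y | e x y]| == 1%N].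

(* The subgraph induced on A is a path, listed from end to end by p; both the
   empty graph and a single vertex qualify. *)
Definition induces_path e (A : {set V}) : Prop :=
  exists p : seq V,
    [/\ uniq p, p =i A
      & {in A &, forall x y, e x y =
          (index y p == (index x p).+1) || (index x p == (index y p).+1)}].

Definition caterpillar_graph e : Prop :=
  tree e /\ induces_path e (~: leaves e).

Definition edge_lengths e w : Prop :=
  forall x y, e x y -> 0 < w x y /\ w x y = w y x.

Fixpoint walk_length w (x : V) (p : seq V) : R :=
  if p is y :: q then w x y + walk_length w y q else 0.

(* Since the minimum is required to be attained, d is determined by e and w
   (and exists whenever e is connected). *)
Definition weighted_path_metric e w d : Prop :=
  forall x y,
    (exists p, [/\ path e x p, last x p = y & d x y = walk_length w x p]) /\
    (forall p, path e x p -> last x p = y -> d x y <= walk_length w x p).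

Definition caterpillar e w d : Prop :=
  [/\ caterpillar_graph e, edge_lengths e w & weighted_path_metric e w d].

End Caterpillar.

Definition drawable_in_caterpillar (R : realType) (S : finType)
    (rho : S -> S -> R) : Prop :=
  exists (V : finType) (e : rel V) (w d : V -> V -> R),
    caterpillar e w d /\ exists I : S -> V, valid_drawing rho d I.

(* From here on S = {1, .., n} with n = m.+1, and the point i of S is the
   ordinal of value i - 1. *)
Section CenterMatrices.
Variables (R : realType) (m : nat) (rho : 'I_m.+1 -> 'I_m.+1 -> R).

(* For i < k the defaults i, resp. k, are themselves admissible indices, so
   these are the genuine maximum and minimum. *)
Definition Lcenter (i k : 'I_m.+1) : 'I_m.+1 :=
  [arg max_(j > i | (i <= j <= k)%N && (rho i j < rho j k)) (j : nat)].

Definition Rcenter (k i : 'I_m.+1) : 'I_m.+1 :=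
  [arg min_(j < k | (i <= j <= k)%N && (rho j k < rho i j)) (j : nat)].

(* The columns are indexed by 'I_(m + m): first h_2, .., h_n, then
   l_2, .., l_n. The vectors hvar i and lvar i are the coefficient vectors of
   h_i and l_i, both zero for the first point. *)
Definition var (i : 'I_m.+1) : 'rV[R]_m := \row_k (lift ord0 k == i)%:R.
Definition hvar (i : 'I_m.+1) : 'rV[R]_(m + m) := row_mx (var i) 0.
Definition lvar (i : 'I_m.+1) : 'rV[R]_(m + m) := row_mx 0 (var i).

(* Row (a, b) of A_S; the value for a = b is irrelevant. *)
Definition A_row (a b : 'I_m.+1) : 'rV[R]_(m + m) :=
  if (a < b)%N
  then hvar a + hvar b - 2 *: hvar (Lcenter a b) - lvar a + lvar b
  else - hvar b - hvar a + 2 *: hvar (Rcenter a b) + lvar b - lvar a.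

Definition B_S : 'M[R]_(m + m) :=
  let cur (k : 'I_m) := widen_ord (leqnSn m) k in
  let next (k : 'I_m) := lift ord0 k in
  col_mx (\matrix_(k < m) A_row (cur k) (next k))
         (\matrix_(k < m) A_row (next k) (cur k)).

(* Its cardinal is m * m.-1 = (n - 1)(n - 2). *)
Definition far_pairs : {set 'I_m.+1 * 'I_m.+1} :=
  [set p : 'I_m.+1 * 'I_m.+1 | (p.1.+1 < p.2)%N || (p.2.+1 < p.1)%N].

Definition N_S : 'M[R]_(#|far_pairs|, m + m) :=
  \matrix_(r < #|far_pairs|) A_row (enum_val r).1 (enum_val r).2.

Definition Y_S : 'M[R]_(m + m, #|far_pairs|) := - (invmx B_S^T *m N_S^T).

End CenterMatrices.

(* Main.v *)
Require Import Defs.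
From mathcomp Require Import all_boot all_order all_algebra.
From mathcomp Require Import reals.
From mathcomp Require Import lra ring zify.

(* In a caterpillar two distinct vertices are at distance
   |pos x - pos y| + leg x + leg y, where pos is the position of the foot of a
   vertex along the spine and leg its distance to the spine. For i < j the form
   of row (i, j) says d(i, L(i,j)) < d(L(i,j), j) when the points lie in order
   along the spine, so a solution of A_S (h, l) > 0 gives a drawing at positions
   h with legs l + c, for a large constant c.

   Conversely a drawing with distances d is replaced by
     u_j = d(1, j),   v_i = d(1, n) - d(i, n),   h = (u + v) / 2,   l = (u - v) / 2.
   For 1 < i < j < n validity gives d(1,i) + d(j,n) < d(1,j) + d(i,n), so the
   four-point condition forces d(i,j) + d(1,n) = d(1,j) + d(i,n), that is
   d(i, j) = u_j - v_i; this holds although the drawing itself need not place the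
   points in order. Validity also makes u and v increasing, and together these
   yield A_S (h, l) > 0.

   Finally, as B_S is invertible, Gordan's alternative for A_S is the system in
   the statement. *)

Set Implicit Arguments.
Unset Strict Implicit.
Unset Printing Implicit Defensive.

Import Order.TTheory GRing.Theory Num.Theory.
Local Open Scope ring_scope.


(** * Gordan's theorem of the alternative *)

Lemma small_scaling (F : realFieldType) (I : finType) (f g : I -> F) :
  (forall i, 0 < f i) -> exists2 eps, 0 < eps & forall i, eps * g i < f i.
Proof.
(* [s] exceeds every ratio [|g i| / f i], so its inverse serves all [i] at once. *)
move=> f_gt0; pose s := 1 + \sum_i `|g i| / f i.
have s_gt0 : 0 < s.
  by rewrite ltr_pwDl // sumr_ge0 // => i _; rewrite divr_ge0 // ltW.
exists s^-1 => [|i]; first by rewrite invr_gt0.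
rewrite mulrC ltr_pdivrMr // mulrC -ltr_pdivrMr //.
apply: (@le_lt_trans _ _ (`|g i| / f i)).
  by rewrite ler_pM2r ?invr_gt0 // ler_norm.
rewrite /s (bigD1 i) //= addrCA ltrDl ltr_pwDl // sumr_ge0 // => j _.
by rewrite divr_ge0 // ltW.
Qed.

(** Induction on the number of rows, with first row [b] and remaining rows [C]. The hard case is a
    solution [x] for [C] with b x < 0: positive multiples of [b] are added to the rows of [C] so
    that they all vanish at [x], and the induction hypothesis is applied to the new rows. *)
Lemma gordan (F : realFieldType) (k d : nat) (A : 'M[F]_(k, d)) :
  (exists x : 'cV_d, forall i, 0 < (A *m x) i 0) \/
  (exists y : 'rV_k, [/\ forall i, 0 <= y 0 i, y != 0 & y *m A = 0]).
Proof.
elim: k A => [|k IHk] A; first by left; exists 0 => -[].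
rewrite -[A](@vsubmxK F 1 k d); move: (usubmx _) (dsubmx _) => b C {A}.
suff: (exists x : 'cV_d, forall i : 'I_(1 + k), 0 < (col_mx b C *m x) i 0) \/
    (exists y : 'rV_(1 + k),
       [/\ forall i, 0 <= y 0 i, y != 0 & y *m col_mx b C = 0]) by [].
have padE (t : F) (y : 'rV_k) :
    0 <= t -> (forall i, 0 <= y 0 i) ->
    forall i : 'I_(1 + k), 0 <= (row_mx t%:M y : 'rV_(1 + k)) 0 i.
  by move=> t0 y0 i; rewrite mxE; case: splitP => j _ //; rewrite ord1 mxE mulr1n.
have pad_neq0 (t : F) (y : 'rV_k) : y != 0 -> (row_mx t%:M y : 'rV_(1 + k)) != 0.
  by apply: contra_neq => /eqP; rewrite row_mx_eq0 => /andP[_ /eqP].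
case: (IHk C) => [[x Cx]|[y [y0 yN0 yC]]]; last first.
  right; exists (row_mx 0%:M y); split; [exact: padE|exact: pad_neq0|].
  by rewrite mul_row_col yC mul_scalar_mx scale0r addr0.
have colP (z : 'cV_d) : 0 < (b *m z) 0 0 -> (forall i, 0 < (C *m z) i 0) ->
    exists z : 'cV_d, forall i : 'I_(1 + k), 0 < (col_mx b C *m z) i 0.
  by move=> bz Cz; exists z => i; rewrite mul_col_mx mxE; case: splitP => j _ //; rewrite ord1.
case: (ltgtP ((b *m x) 0 0) 0) => [bx|bx|bx]; last 2 first.
- by left; exact: (colP x).
- have [b0|bN0] := eqVneq b 0.
    right; exists (row_mx 1%:M 0); split; [by apply: padE => // i; rewrite mxE| |].
      apply/eqP => /(congr1 (fun M : 'rV_(1 + k) => lsubmx M 0 0)) /eqP.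
      by rewrite row_mxKl !mxE mulr1n oner_eq0.
    by rewrite mul_row_col mul0mx mul1mx b0 addr0.
  have bb : 0 < (b *m b^T) 0 0.
    have [j bj] : exists j, b 0 j != 0.
      apply/existsP; apply: contraNT bN0; rewrite negb_exists => /forallP bj.
      by apply/eqP/rowP => j; rewrite mxE; apply/eqP; rewrite -[_ == _]negbK bj.
    rewrite mxE (bigD1 j) //= mxE ltr_pwDl //; first by rewrite -expr2 exprn_even_gt0.
    by rewrite sumr_ge0 // => i _; rewrite mxE -expr2 sqr_ge0.
  (* From the hyperplane b x = 0, a small step along b^T makes the first row positive and keeps the
     others positive. *)
  have [eps eps0 epsP] := small_scaling (fun i => - (C *m b^T) i 0) Cx.
  left; apply: (colP (x + eps *: b^T)) => [|i].
    by rewrite mulmxDr -scalemxAr mxE [X in _ + X]mxE bx add0r mulr_gt0.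
  rewrite mulmxDr -scalemxAr mxE [X in _ + X]mxE; have := epsP i; have := Cx i; lra.
(* [c] is chosen with (C + c b) x = 0. Its entries are positive, so a certificate [y] for C + c b
   turns into the nonnegative certificate (y c, y) for the original rows. *)
pose beta := (b *m x) 0 0; pose c : 'cV_k := - beta^-1 *: (C *m x).
have c_gt0 i : 0 < c i 0 by rewrite mxE mulr_gt0 // oppr_gt0 invr_lt0.
have bmx (z : 'cV_d) : b *m z = ((b *m z) 0 0)%:M by exact: mx11_scalar.
case: (IHk (C + c *m b)) => [[z Cz]|[y [y0 yN0 yC]]]; last first.
  right; exists (row_mx ((y *m c) 0 0)%:M y); split; [|exact: pad_neq0|].
    by apply: padE => //; rewrite mxE sumr_ge0 // => i _; rewrite mulr_ge0 // ltW.
  by rewrite mul_row_col -mx11_scalar addrC -mulmxA -mulmxDr.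
have [eps eps0 epsP] := small_scaling (fun i => c i 0) Cz.
(* Moving along [x] does not change (C + c b) z. The amount [t] gives [b] the value [eps], which
   leaves [C] with the value (C + c b) z - eps c. *)
left; pose t := (eps - (b *m z) 0 0) / beta.
have bzt : b *m (z + t *: x) = eps%:M.
  rewrite mulmxDr -scalemxAr (bmx z) (bmx x) -/beta scale_scalar_mx -raddfD /=.
  by congr (_ %:M); rewrite /t; field; rewrite lt_eqF.
have Cx0 : (C + c *m b) *m x = 0.
  rewrite mulmxDl -mulmxA (bmx x) -/beta mul_mx_scalar /c scalerA mulrN divff ?lt_eqF //.
  by rewrite scaleN1r subrr.
have Czt : C *m (z + t *: x) = (C + c *m b) *m z - eps *: c.
  have <- : (C + c *m b) *m (z + t *: x) = (C + c *m b) *m z.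
    by rewrite mulmxDr -scalemxAr Cx0 scaler0 addr0.
  by rewrite mulmxDl -mulmxA bzt mul_mx_scalar addrK.
apply: (colP (z + t *: x)) => [|i]; first by rewrite bzt mxE.
by rewrite Czt !mxE subr_gt0; have := epsP i; rewrite !mxE.
Qed.


(** * Walks, and the path metric of a spine with legs *)

Section Walks.
Variables (R : realType) (V : finType) (e : rel V) (w : V -> V -> R).
Hypothesis e_sym : symmetric e.

Definition walk (x y : V) (r : R) :=
  exists p, [/\ path e x p, last x p = y & r = walk_length w x p].

Lemma walk0 x : walk x x 0. Proof. by exists [::]. Qed.

Lemma walk_edge x y : e x y -> walk x y (w x y).
Proof. by move=> exy; exists [:: y]; split=> //=; rewrite ?exy ?addr0. Qed.

Lemma walk_trans y x z r s : walk x y r -> walk y z s -> walk x z (r + s).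
Proof.
move=> [p [xp py ->]] [q [yq qz ->]]; exists (p ++ q); split.
- by rewrite cat_path xp py.
- by rewrite last_cat py.
elim: p x xp py => /= [x _ <-|a p IHp x /andP[_ xp] py]; first by rewrite add0r.
by rewrite -addrA IHp.
Qed.

Hypothesis w_sym : forall x y, e x y -> w x y = w y x.

Lemma walk_sym x y r : walk x y r -> walk y x r.
Proof.
case=> p [xp <- ->] {y r}; elim: p x xp => [x _|a p IHp x /=/andP[exa ap]]; first exact: walk0.
rewrite addrC; apply: walk_trans (IHp _ ap) _.
by rewrite (w_sym exa); apply: walk_edge; rewrite e_sym.
Qed.

End Walks.

Section LegMetric.
Variables (R : realType) (V : finType).
Implicit Types (e : rel V) (w : V -> V -> R).

Lemma weighted_path_metric_uniq e w (d d' : V -> V -> R) :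
  weighted_path_metric e w d -> weighted_path_metric e w d' -> d =2 d'.
Proof.
move=> dP d'P x y; have [[p [xp py dE]] dle] := dP x y.
have [[q [xq qy d'E]] d'le] := d'P x y.
by apply/le_anti/andP; split; [rewrite d'E dle | rewrite dE d'le].
Qed.

(** The diagonal is a separate case, since the formula there would give twice the leg. *)
Definition leg_dist (pos leg : V -> R) (x y : V) : R :=
  if x == y then 0 else `|pos x - pos y| + leg x + leg y.

(** By the triangle inequality on the line no walk is shorter than [leg_dist]; the walk from [x] to
    its foot, along the spine [p], and from the other foot to [y] attains it. *)
Lemma leg_dist_metric e w (pos leg : V -> R) (foot : V -> V) (p : seq V) :
  symmetric e ->
  (forall x y, e x y -> w x y = `|pos x - pos y| + leg x + leg y) ->
  (forall x, 0 <= leg x) ->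
  (forall x, x \in p -> leg x = 0) ->
  (forall x, [/\ foot x \in p, pos (foot x) = pos x
    & x != foot x -> e x (foot x)]) ->
  (forall x0 i, (i.+1 < size p)%N -> e (nth x0 p i) (nth x0 p i.+1) /\
    pos (nth x0 p i) <= pos (nth x0 p i.+1)) ->
  weighted_path_metric e w (leg_dist pos leg).
Proof.
move=> e_sym wE leg_ge0 leg_p footP p_path x y; split; last first.
  move=> q; elim: q x => [x _ <-|z q IHq x /=/andP[exz zq] qy].
    by rewrite /leg_dist eqxx.
  apply: le_trans (lerD (lexx _) (IHq z zq qy)); rewrite wE // /leg_dist.
  have := leg_ge0 x; have := leg_ge0 y; have := leg_ge0 z.
  have := ler_distD (pos z) (pos x) (pos y).
  have := normr_ge0 (pos x - pos z); have := normr_ge0 (pos z - pos y).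
  by case: eqVneq => [_|_]; case: eqVneq => [->|_]; lra.
have w_sym a b : e a b -> w a b = w b a.
  by move=> eab; rewrite (wE _ _ eab) wE 1?e_sym // distrC addrAC.
suff: walk e w x y (leg_dist pos leg x y) by [].
rewrite /leg_dist; case: eqVneq => [->|_]; first exact: walk0.
have to_foot z : walk e w z (foot z) (leg z).
  have [/leg_p leg0 posE e_foot] := footP z; have [zf|/e_foot ezf] := eqVneq z (foot z).
    by rewrite -zf in leg0 *; rewrite leg0; exact: walk0.
  by have := walk_edge w ezf; rewrite wE // posE leg0 subrr normr0 add0r addr0.
have spine i j : (i <= j < size p)%N ->
    0 <= pos (nth x p j) - pos (nth x p i) /\
    walk e w (nth x p i) (nth x p j) (pos (nth x p j) - pos (nth x p i)).
  elim: j => [|j IHj] /andP[ij jp].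
    by move: ij; rewrite leqn0 => /eqP ->; rewrite subrr; split=> //; exact: walk0.
  move: ij; rewrite leq_eqVlt => /predU1P[->|ij]; first by rewrite subrr; split=> //; exact: walk0.
  have [ejj lejj] := p_path x _ jp.
  have [|ge0 wk] := IHj; first by rewrite -ltnS ij (ltnW jp).
  split; first by rewrite -(subrKA (pos (nth x p j))) addr_ge0 // subr_ge0.
  have := walk_trans wk (walk_edge w ejj).
  rewrite wE // !leg_p ?mem_nth ?(ltnW jp) // !addr0 distrC ger0_norm ?subr_ge0 //.
  by congr (walk _ _ _ _ _); lra.
have [[/[dup] fx /leg_p legx posx _] [/[dup] fy /leg_p legy posy _]] := (footP x, footP y).
have foot_walk : walk e w (foot x) (foot y) `|pos x - pos y|.
  have spine' a b : a \in p -> b \in p -> (index a p <= index b p)%N ->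
      0 <= pos b - pos a /\ walk e w a b (pos b - pos a).
    move=> ap bp ab.
    by have := spine (index a p) (index b p); rewrite !nth_index // ab index_mem; apply.
  rewrite -posx -posy; case: (leqP (index (foot x) p) (index (foot y) p)) => [le|/ltnW le].
    have [ge0 wk] := spine' _ _ fx fy le; by rewrite distrC ger0_norm.
  have [ge0 wk] := spine' _ _ fy fx le; rewrite ger0_norm //; exact: walk_sym.
have := walk_trans (walk_trans (to_foot x) foot_walk) (walk_sym e_sym w_sym (to_foot y)).
by rewrite [leg x + _]addrC.
Qed.

End LegMetric.


(** All three pairings of four distinct points carry the same sum of legs, so only positions on a
    line matter. There the two largest of the three sums agree, and the hypothesis says that the
    first pairing is not among the largest. *)
Lemma leg_dist_four_point (R : realType) (V : finType) (pos leg : V -> R)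
    (d : V -> V -> R) (a x y b : V) :
  d =2 leg_dist pos leg -> uniq [:: a; x; y; b] ->
  d a x + d y b < d a y + d x b -> d x y + d a b = d a y + d x b.
Proof.
move=> dE; rewrite /= !inE !negb_or -!andbA andbT => /and5P[ax ay ab xy /andP[xb yb]].
rewrite !dE /leg_dist !ifN //.
by do 6![case: ger0P => ?]; lra.
Qed.

(** * Every caterpillar metric is a leg metric *)

Section Leaves.
Variables (V : finType) (e : rel V).
Hypothesis e_conn : forall x y, connect e x y.

Lemma leafP x : reflect (exists y, forall z, e x z = (z == y)) (x \in leaves e).
Proof.
rewrite inE; apply: (iffP cards1P) => -[y yP]; exists y.
  by move=> z; have := congr1 (fun A : {set V} => z \in A) yP; rewrite !inE.
by apply/setP => z; rewrite !inE.
Qed.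

Hypothesis e_sym : symmetric e.

(** Neither leaf has a further neighbour, so {x, y} is closed under adjacency and connectivity makes
    it everything. *)
Lemma adjacent_leaves x y :
  e x y -> x \in leaves e -> y \in leaves e -> forall z, z = x \/ z = y.
Proof.
move=> exy /leafP[x' xP] /leafP[y' yP] z.
have xx' : y = x' by apply/eqP; rewrite -xP.
have yy' : x = y' by apply/eqP; rewrite -yP e_sym.
subst x' y'; suff: z \in [set x; y] by rewrite !inE => /orP[] /eqP; auto.
have cl : closed e [set x; y].
  apply: (intro_closed (sym_connect_sym e_sym)) => a b eab; rewrite !inE => /orP[] /eqP aE;
    move: eab; rewrite aE.
    by rewrite xP => ->; rewrite orbT.
  by rewrite yP => ->.
by rewrite -(closed_connect cl (e_conn x z)) !inE eqxx.
Qed.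

(* When the caterpillar is a single edge, every vertex is a leaf; one of the two
   then plays the role of the spine. *)
Lemma caterpillar_spine : (0 < #|V|)%N -> irreflexive e -> induces_path e (~: leaves e) ->
  exists (p : seq V) (foot : V -> V),
    [/\ uniq p, forall x, foot x \in p,
      forall x, x \in p -> foot x = x,
      forall x, x \notin p -> forall y, e x y = (y == foot x)
      & {in p &, forall x y, e x y =
          (index y p == (index x p).+1) || (index x p == (index y p).+1)}].
Proof.
move=> /card_gt0P[x0 _] e_irr [[|s p] [p_uniq pE p_path]].
  exists [:: x0], (fun=> x0); split=> //.
  - by move=> x; rewrite inE.
  - by move=> x; rewrite inE => /eqP.
  - have leaf x : x \in leaves e by have := pE x; rewrite inE; case: (x \in _).
    have [y0 x0P] := leafP _ (leaf x0); have ex0 : e x0 y0 by rewrite x0P.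
    have only := adjacent_leaves ex0 (leaf x0) (leaf y0).
    move=> x; rewrite inE => xx0 y; have [xE|xE] := only x; first by rewrite xE eqxx in xx0.
    have [z0 y0P] := leafP _ (leaf y0).
    have : e y0 x0 by rewrite e_sym.
    by rewrite xE !y0P => /eqP ->.
  by move=> x y; rewrite !inE => /eqP -> /eqP ->; rewrite e_irr /= eqxx.
(* A vertex outside the spine is a leaf, for which [pick] finds the unique neighbour; the default is
   never reached there. *)
pose foot x := if x \in s :: p then x else odflt x [pick y | e x y].
have footP x : x \notin s :: p -> forall y, e x y = (y == foot x).
  rewrite /foot => /[dup] xp /negbTE ->.
  have /leafP[y yP] : x \in leaves e by rewrite pE inE negbK in xp.
  move=> z; case: pickP => [y' /=|none]; last by have := none y; rewrite /= (yP y) eqxx.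
  by rewrite yP => /eqP ->; rewrite yP.
exists (s :: p), foot; split=> //.
- move=> x; have [xp|xp] := boolP (x \in s :: p); first by rewrite /foot xp.
  have exf : e x (foot x) by rewrite footP.
  (* Were the foot of a leaf itself a leaf, these two would be the only vertices, although [s] is
     not a leaf. *)
  apply/negPn/negP => fp.
  have := adjacent_leaves exf; rewrite pE inE negbK in xp; rewrite pE inE negbK in fp.
  move=> /(_ xp fp s) sE; have : s \notin leaves e by rewrite -in_setC -pE mem_head.
  by case: sE => ->; rewrite ?xp ?fp.
- by move=> x xp; rewrite /foot xp.
- by move=> x y xp yp; apply: p_path; rewrite -pE.
Qed.
End Leaves.

(** Positions are partial sums of edge lengths along the spine up to the foot, legs are the lengths
    of the pendant edges. The resulting [leg_dist] is a path metric for the same weights, hence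
    equals [d]. *)
Lemma caterpillar_leg_dist (R : realType) (V : finType) (e : rel V) (w d : V -> V -> R) :
  caterpillar e w d -> exists pos leg, d =2 leg_dist pos leg.
Proof.
move=> [[[[e_sym e_irr] V0 e_conn _] e_path] w_len dP].
have [p [foot [p_uniq foot_p foot_id foot_leaf p_edge]]] := caterpillar_spine e_conn e_sym V0 e_irr e_path.
have /card_gt0P[x0 _] := V0.
pose pos x := \sum_(j < index (foot x) p) w (nth x0 p j) (nth x0 p j.+1).
pose leg x := if x \in p then 0 else w x (foot x).
exists pos, leg; apply: (weighted_path_metric_uniq dP).
have pos_foot x : pos (foot x) = pos x by rewrite /pos (foot_id (foot x)).
have pos_next x y : x \in p -> y \in p -> index y p = (index x p).+1 ->
    e x y /\ pos y = pos x + w x y.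
  move=> xp yp yE; split; first by rewrite p_edge // yE eqxx.
  by rewrite /pos (foot_id y) // (foot_id x) // yE big_ord_recr /= -yE !nth_index.
have leaf_edge x y : e x y -> x \notin p -> y \in p /\ w x y = `|pos x - pos y| + leg x + leg y.
  move=> exy xp; have yE : y = foot x by apply/eqP; rewrite -foot_leaf.
  by rewrite yE pos_foot subrr normr0 add0r /leg (negbTE xp) foot_p addr0.
apply: (leg_dist_metric (foot := foot) (p := p)) => //.
- move=> x y exy; have [xp|xp] := boolP (x \in p); last by have [] := leaf_edge _ _ exy xp.
  have [yp|yp] := boolP (y \in p); last first.
    have eyx : e y x by rewrite e_sym.
    by have [_ wE] := leaf_edge _ _ eyx yp; rewrite (w_len _ _ exy).2 wE distrC addrAC.
  rewrite /leg xp yp !addr0; have := exy; rewrite p_edge // => /orP[/eqP i|/eqP i].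
    have [_ ->] := pos_next x y xp yp i; rewrite opprD addrA subrr add0r normrN gtr0_norm //.
    exact: (w_len _ _ exy).1.
  have [_ ->] := pos_next y x yp xp i; rewrite addrAC subrr add0r -(w_len _ _ exy).2 gtr0_norm //.
  exact: (w_len _ _ exy).1.
- move=> x; rewrite /leg; case: ifPn => // xp.
  have exf : e x (foot x) by rewrite foot_leaf.
  exact: ltW (w_len _ _ exf).1.
- by move=> x xp; rewrite /leg xp.
- move=> x; split=> // xf; rewrite foot_leaf //; apply: contra xf => xp; by rewrite foot_id.
- move=> z i ip; have ip' := ltnW ip.
  have [||| -> ->] := pos_next (nth z p i) (nth z p i.+1); rewrite ?mem_nth ?index_uniq //.
  split=> //; rewrite lerDl ltW // (w_len _ _ _).1 // p_edge ?mem_nth // !index_uniq //.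
  by rewrite eqxx.
Qed.

(** * Combs: caterpillars with prescribed positions and legs *)

(** On a cycle with at least three vertices, one of maximal rank would have two distinct neighbours
    of smaller rank. *)
Lemma acyclic_of_rank (V : finType) (e : rel V) (rank : V -> nat) :
  symmetric e -> (forall x y, e x y -> rank x != rank y) ->
  (forall x y z, e x y -> e x z -> (rank y < rank x)%N -> (rank z < rank x)%N -> y = z) ->
  forall c : seq V, ucycle e c -> (size c <= 2)%N.
Proof.
move=> e_sym rank_neq down_uniq [//|x c] /andP[c_cyc c_uniq].
pose v := [arg max_(y > x in x :: c) rank y].
have [vc v_max] : v \in x :: c /\ forall y, y \in x :: c -> (rank y <= rank v)%N.
  by rewrite /v; case: arg_maxnP => [|y yc yP]; [exact: mem_head | split].
have [i q cE] := rot_to vc.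
have := size_rot i (x :: c); rewrite cE => <-.
have : cycle e (v :: q) by rewrite -cE rot_cycle.
have : uniq (v :: q) by rewrite -cE rot_uniq.
have {}v_max y : y \in v :: q -> (rank y <= rank v)%N by rewrite -cE mem_rot; exact: v_max.
case: q {cE} v_max => [//|a q] v_max; case/lastP: q v_max => [//|q b] v_max.
rewrite /= rcons_path last_rcons => /and3P[_ ab _] /and3P[eva _ ebv].
case/negP: ab; rewrite mem_rcons.
have lt y : y \in [:: v, a & rcons q b] -> e v y -> (rank y < rank v)%N.
  by move=> /v_max le evy; rewrite ltn_neqAle le eq_sym rank_neq.
rewrite e_sym in ebv; rewrite (down_uniq v a b) ?inE ?eqxx //; apply: lt => //.
  by rewrite !inE eqxx orbT.
by rewrite !inE mem_rcons inE eqxx !orbT.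
Qed.


Section Comb.
Variables (R : realType) (m : nat) (h l : 'I_m.+1 -> R).
Hypotheses (m_gt0 : (0 < m)%N) (l_gt0 : forall i, 0 < l i)
  (h_incr : forall i j : 'I_m.+1, (i < j)%N -> h i < h j).

(* [(i, true)] is the i-th vertex of the spine, [(i, false)] the end of its leg. *)
Let V : finType := ('I_m.+1 * bool)%type.
Let pos (x : V) := h x.1.
Let leg (x : V) := if x.2 then 0 else l x.1.

Definition comb_edge : rel V := fun x y =>
  if x.2 && y.2 then (y.1 == x.1.+1 :> nat) || (x.1 == y.1.+1 :> nat)
  else (x.2 != y.2) && (x.1 == y.1).

Definition comb_spine : seq V := [seq (i, true) | i <- enum 'I_m.+1].

Lemma comb_edge_sym : symmetric comb_edge.
Proof.
move=> [i a] [j b]; rewrite /comb_edge /= andbC orbC.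
by case: ifP => // _; rewrite eq_sym [i == j]eq_sym.
Qed.

Lemma mem_comb_spine x : (x \in comb_spine) = x.2.
Proof.
case: x => i [] /=; first by apply: map_f; rewrite mem_enum.
by apply/negbTE/mapP => -[].
Qed.

Lemma index_comb_spine i : index (i, true) comb_spine = i.
Proof. by rewrite index_map ?index_enum_ord // => a b []. Qed.

(** As m > 0, each spine vertex has a spine neighbour besides the end of its leg: the second vertex
    if it is the first, its predecessor otherwise. *)
Lemma leaves_comb : leaves comb_edge = [set x | ~~ x.2].
Proof.
apply/setP => -[i b]; rewrite [RHS]inE /=; apply/leafP/idP => [[y yP]|].
  apply/negP => bT; rewrite bT in yP.
  have /eqP yE : (i, false) == y by rewrite -yP /comb_edge /= eqxx.
  have no_true j : comb_edge (i, true) (j, true) = false by rewrite yP -yE; apply/eqP => -[].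
  have [i0|i0] := posnP i.
    by have := no_true (Ordinal (m_gt0 : (1 < m.+1)%N)); rewrite /comb_edge /= i0.
  have im : (i.-1 < m.+1)%N by rewrite (leq_ltn_trans (leq_pred _)).
  by have := no_true (Ordinal im); rewrite /comb_edge /= prednK // eqxx orbT.
case: b => // _; exists (i, true) => -[j b]; rewrite /comb_edge /= [i == j]eq_sym.
by case: b; rewrite /= ?andbT ?andbF // xpair_eqE ?andbT ?andbF.
Qed.

Let w (x y : V) := `|pos x - pos y| + leg x + leg y.

Lemma comb_metric : weighted_path_metric comb_edge w (leg_dist pos leg).
Proof.
apply: (leg_dist_metric (foot := fun x => (x.1, true)) (p := comb_spine)) => //.
- exact: comb_edge_sym.
- by move=> [i []]; rewrite /leg //= ltW.
- by move=> x; rewrite mem_comb_spine /leg => ->.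
- case=> i b; split; [by rewrite mem_comb_spine | by [] |].
  by case: b => //; rewrite ?eqxx //= /comb_edge /= eqxx.
move=> x0 i; rewrite size_map size_enum_ord => im.
have nthE k : (k < m.+1)%N -> nth x0 comb_spine k = (inord k, true).
  move=> km; rewrite (nth_map ord0) ?size_enum_ord //; congr (_, _).
  by apply: val_inj; rewrite /= nth_enum_ord // inordK.
rewrite !nthE ?(ltnW im) //; split; first by rewrite /comb_edge /= !inordK ?(ltnW im) ?eqxx.
by rewrite ltW // h_incr // !inordK // ltnW.
Qed.

Lemma comb_caterpillar : caterpillar comb_edge w (leg_dist pos leg).
Proof.
split; last exact: comb_metric.
- split; last first.
    exists comb_spine; split.
    + by rewrite map_inj_uniq ?enum_uniq // => a b [].
    + by move=> x; rewrite mem_comb_spine leaves_comb !inE negbK.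
    + move=> [i a] [j b]; rewrite leaves_comb !inE !negbK /= => -> ->.
      by rewrite !index_comb_spine.
  split.
  + split; first exact: comb_edge_sym.
    by move=> [i []] //; rewrite /comb_edge /= orbb; apply/eqP; lia.
  + by apply/card_gt0P; exists (ord0, true).
  (* Connectivity is read off from the walks that realise the metric. *)
  + move=> x y; have [[p [xp <- _]] _] := comb_metric x y.
    by apply/connectP; exists p.
  (* Leg ends rank above the whole spine: a leg end only has its spine vertex below it, a spine
     vertex only its predecessor. *)
  apply: (acyclic_of_rank (rank := fun x : V => if x.2 then x.1 : nat else m.+1)).
  + exact: comb_edge_sym.
  + move=> [i []] [j []]; rewrite /comb_edge //=; have := ltn_ord i; have := ltn_ord j; lia.
  move=> [i a] [j b] [k c]; rewrite /comb_edge /=.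
  have := ltn_ord i; have := ltn_ord j; have := ltn_ord k.
  case: a; case: b; case: c => //=; try lia.
    by move=> _ _ _ ij ik ji ki; congr (_, _); apply: val_inj; rewrite /=; lia.
  by move=> _ _ _ /eqP -> /eqP ->.
move=> [i a] [j b] exy; split; last by rewrite /w distrC addrAC.
move: exy; rewrite /comb_edge /w /leg /pos /=.
have := l_gt0 i; have := l_gt0 j; have := normr_ge0 (h i - h j).
case: a; case: b => //=; try lra.
move=> _ _ _ ij; rewrite !addr0 normr_gt0 subr_eq0.
by case/orP: ij => ij; [rewrite lt_eqF|rewrite gt_eqF] => //; apply: h_incr; lia.
Qed.

Lemma exists_comb : exists (V : finType) (e : rel V) (w d : V -> V -> R) (I : 'I_m.+1 -> V),
  [/\ caterpillar e w d, injective I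
    & forall i j, d (I i) (I j) = if i == j then 0 else `|h i - h j| + l i + l j].
Proof.
exists V, comb_edge, w, (leg_dist pos leg), (fun i => (i, false)); split.
- exact: comb_caterpillar.
- by move=> i j [].
- by move=> i j; rewrite /leg_dist xpair_eqE eqxx andbT.
Qed.

End Comb.


(** * The linear system and its alternative *)

Section System.
Variables (R : realType) (m : nat) (rho : 'I_m.+1 -> 'I_m.+1 -> R).

Lemma in_far_pairs (a b : 'I_m.+1) : ((a, b) \in far_pairs m) = ((a.+1 < b) || (b.+1 < a))%N.
Proof. by rewrite inE. Qed.

Definition hval (X : 'cV[R]_(m + m)) i := (hvar R i *m X) 0 0.
Definition lval (X : 'cV[R]_(m + m)) i := (lvar R i *m X) 0 0.

Lemma A_rowE X a b : (A_row rho a b *m X) 0 0 =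
  if (a < b)%N
  then hval X a + hval X b - 2 * hval X (Lcenter rho a b) - lval X a + lval X b
  else - hval X b - hval X a + 2 * hval X (Rcenter rho a b) + lval X b - lval X a.
Proof.
rewrite /A_row; case: ifP => _;
  by rewrite ?mulmxDl ?mulNmx -?scalemxAl /hval /lval !mxE.
Qed.

Lemma var_mul (g : 'I_m.+1 -> R) i : g ord0 = 0 ->
  (var R i *m \col_k g (lift ord0 k)) 0 0 = g i.
Proof.
move=> g0; rewrite mxE; under eq_bigr do rewrite !mxE.
case: (unliftP ord0 i) => [j ->|->]; last first.
  by rewrite g0 big1 // => k _; rewrite eq_sym (negbTE (neq_lift _ _)) mul0r.
rewrite (bigD1 j) //= eqxx mul1r big1 ?addr0 // => k kj.
by rewrite (inj_eq (@lift_inj _ _)) (negbTE kj) mul0r.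
Qed.

Lemma exists_hlval (h l : 'I_m.+1 -> R) : h ord0 = 0 -> l ord0 = 0 ->
  exists X, hval X =1 h /\ lval X =1 l.
Proof.
move=> h0 l0; exists (col_mx (\col_k h (lift ord0 k)) (\col_k l (lift ord0 k))).
by split=> i; rewrite /hval /lval mul_row_col mul0mx ?addr0 ?add0r var_mul.
Qed.

Lemma hlval0 X : hval X ord0 = 0 /\ lval X ord0 = 0.
Proof.
have var0 : var R (ord0 : 'I_m.+1) = 0.
  by apply/rowP => k; rewrite !mxE eq_sym (negbTE (neq_lift _ _)).
by rewrite /hval /lval /hvar /lvar var0 row_mx0 mul0mx mxE.
Qed.

Lemma hlval_inj X : hval X =1 (fun=> 0) -> lval X =1 (fun=> 0) -> X = 0.
Proof.
have valE (Y : 'cV[R]_m) k : (var R (lift ord0 k) *m Y) 0 0 = Y k 0.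
  rewrite mxE (bigD1 k) //= !mxE eqxx mul1r big1 ?addr0 // => j jk.
  by rewrite mxE (inj_eq (@lift_inj _ _)) (negbTE jk) mul0r.
rewrite -[X]vsubmxK => h0 l0; rewrite -[RHS]col_mx0; congr col_mx; apply/colP => k.
  by have := h0 (lift ord0 k); rewrite /hval mul_row_col mul0mx addr0 valE => ->; rewrite mxE.
by have := l0 (lift ord0 k); rewrite /lval mul_row_col mul0mx add0r valE => ->; rewrite mxE.
Qed.

Hypothesis rho_dis : dissimilarity rho.

(** The default [i] is admissible because rho(i,i) = 0 < rho(i,k), while [k] is not, whence the
    strict bound on the right. *)
Lemma LcenterP (i k : 'I_m.+1) : (i < k)%N ->
  [/\ (i <= Lcenter rho i k)%N, (Lcenter rho i k < k)%N,
    rho i (Lcenter rho i k) < rho (Lcenter rho i k) k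
  & forall j : 'I_m.+1, (i <= j <= k)%N -> rho i j < rho j k -> (j <= Lcenter rho i k)%N].
Proof.
case: rho_dis => rho_ge0 _ rho_eq0 ik.
have rho0 x : rho x x = 0 by apply/rho_eq0.
rewrite /Lcenter; case: arg_maxnP => [|L /andP[/andP[iL Lk] rL] Lmax].
  rewrite leqnn ltnW //= rho0 lt_neqAle rho_ge0 andbT eq_sym.
  by apply/eqP => /rho_eq0 ikE; rewrite ikE ltnn in ik.
split=> // [|j ijk rj]; last by apply: Lmax; rewrite ijk.
rewrite ltn_neqAle Lk andbT; apply/eqP => /val_inj LE.
by move: rL; rewrite LE rho0 ltNge rho_ge0.
Qed.

Lemma RcenterP (i k : 'I_m.+1) : (i < k)%N ->
  [/\ (i < Rcenter rho k i)%N, (Rcenter rho k i <= k)%N,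
    rho (Rcenter rho k i) k < rho i (Rcenter rho k i)
  & forall j : 'I_m.+1, (i <= j <= k)%N -> rho j k < rho i j -> (Rcenter rho k i <= j)%N].
Proof.
case: rho_dis => rho_ge0 _ rho_eq0 ik.
have rho0 x : rho x x = 0 by apply/rho_eq0.
rewrite /Rcenter; case: arg_minnP => [|L /andP[/andP[iL Lk] rL] Lmax].
  rewrite leqnn ltnW //= rho0 lt_neqAle rho_ge0 andbT eq_sym.
  by apply/eqP => /rho_eq0 ikE; rewrite ikE ltnn in ik.
split=> // [|j ijk rj]; last by apply: Lmax; rewrite ijk.
rewrite ltn_neqAle iL andbT; apply/eqP => /val_inj LE.
by move: rL; rewrite -LE rho0 ltNge rho_ge0.
Qed.

(** Between neighbours the centers are forced, L = a and R = b, so the two rows are the increments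
    of h + l and h - l. *)
Lemma A_row_next X (a b : 'I_m.+1) : b = a.+1 :> nat ->
  (A_row rho a b *m X) 0 0 = hval X b + lval X b - (hval X a + lval X a) /\
  (A_row rho b a *m X) 0 0 = hval X b - lval X b - (hval X a - lval X a).
Proof.
move=> abE; have ab : (a < b)%N by rewrite abE.
have [aL Lb _ _] := LcenterP ab; have [aRc Rb _ _] := RcenterP ab.
rewrite !A_rowE ab ltnNge (ltnW ab) /=.
have -> : Lcenter rho a b = a by apply: val_inj; rewrite /=; lia.
have -> : Rcenter rho b a = b by apply: val_inj; rewrite /=; lia.
by split; lra.
Qed.

Let cur (k : 'I_m) : 'I_m.+1 := widen_ord (leqnSn m) k.
Let next (k : 'I_m) : 'I_m.+1 := lift ord0 k.

Lemma B_S_mul X : B_S rho *m X =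
  col_mx (\col_(k < m) (A_row rho (cur k) (next k) *m X) 0 0)
         (\col_(k < m) (A_row rho (next k) (cur k) *m X) 0 0).
Proof.
rewrite /B_S mul_col_mx; congr col_mx; apply/colP => k; rewrite !mxE;
  by apply: eq_bigr => j _; rewrite !mxE.
Qed.

Lemma N_S_mul (X : 'cV[R]_(m + m)) (r : 'I_#|far_pairs m|) :
  (N_S rho *m X) r 0 = (A_row rho (enum_val r).1 (enum_val r).2 *m X) 0 0.
Proof. by rewrite !mxE; apply: eq_bigr => j _; rewrite mxE. Qed.

Lemma eq0_by_steps (g : 'I_m.+1 -> R) :
  g ord0 = 0 -> (forall k, g (next k) = g (cur k)) -> g =1 (fun=> 0).
Proof.
move=> g0 gS [i im]; elim: i im => [|i IHi] im.
  by rewrite -[RHS]g0; congr g; apply: val_inj.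
rewrite -[RHS](IHi (ltnW im)); have im' : (i < m)%N by [].
have -> : Ordinal im = next (Ordinal im') by apply: val_inj; rewrite /= /bump add1n.
by rewrite gS; congr g; apply: val_inj.
Qed.

(** On the kernel all increments of h + l and h - l vanish, so h and l keep their value 0 at the
    first point. *)
Lemma B_S_unit : B_S rho \in unitmx.
Proof.
rewrite -unitmx_tr -row_free_unit; apply: inj_row_free => v vB.
have BX : B_S rho *m v^T = 0 by apply: trmx_inj; rewrite trmx_mul trmxK trmx0.
apply: trmx_inj; rewrite trmx0; move: v^T BX => X {v vB}.
rewrite B_S_mul => BX; have := etrans BX (esym (col_mx0 _ _ _ _)).
move=> /eq_col_mx[/colP up /colP dn].
have [h0 l0] := hlval0 X.
have step k : hval X (next k) = hval X (cur k) /\ lval X (next k) = lval X (cur k).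
  have upk := up k; have dnk := dn k.
  rewrite mxE [RHS]mxE in upk; rewrite mxE [RHS]mxE in dnk.
  have nE : next k = (cur k).+1 :> nat by rewrite /= /bump add1n.
  have [upE dnE] := A_row_next X nE; rewrite upE in upk; rewrite dnE in dnk.
  by split; lra.
by apply: hlval_inj; apply: eq0_by_steps => // k; case: (step k).
Qed.

(** With [B_S] invertible, z = Y_S y amounts to B_S^T z + N_S^T y = 0. Solutions [y] are thus Gordan
    certificates (z, y) for the rows of [B_S] and [N_S] together. *)
Lemma A_row_alternative :
  (exists X : 'cV[R]_(m + m), forall a b : 'I_m.+1, a != b -> 0 < (A_row rho a b *m X) 0 0) <->
  ~ exists y : 'cV[R]_#|far_pairs m|,
      [/\ forall i, 0 <= (Y_S rho *m y) i 0, forall r, 0 <= y r 0 & y <> 0].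
Proof.
have BT_unit : (B_S rho)^T \in unitmx by rewrite unitmx_tr B_S_unit.
split=> [[X XP] [y [z_ge0 y_ge0 y_neq0]]|noY].
  have BX i : 0 < (B_S rho *m X) i 0.
    rewrite B_S_mul mxE; case: splitP => k _; rewrite mxE XP //;
      by rewrite -val_eqE /= /bump; lia.
  have NX r : 0 < (N_S rho *m X) r 0.
    rewrite N_S_mul XP //; have := enum_valP r; case: (enum_val r) => a b.
    by rewrite in_far_pairs /= -val_eqE /=; lia.
  apply: y_neq0; apply/colP => r; rewrite mxE.
  pose z := Y_S rho *m y.
  have zy : (B_S rho)^T *m z + (N_S rho)^T *m y = 0.
    by rewrite /z /Y_S mulNmx mulmxN mulmxA mulmxA mulmxV // mul1mx addNr.
  (* Pairing the certificate with [X] gives a vanishing sum of nonnegative terms; since N_S X > 0,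
     this forces y = 0. *)
  have : (z^T *m (B_S rho *m X) + y^T *m (N_S rho *m X)) 0 0 = 0.
    have := congr1 (fun M : 'cV_(m + m) => (M^T *m X) 0 0) zy.
    rewrite /= linearD /= !trmx_mul !trmxK mulmxDl !mulmxA trmx0 mul0mx => ->.
    by rewrite mxE.
  rewrite mxE => /eqP; rewrite paddr_eq0; first last.
  - by rewrite mxE sumr_ge0 // => i _; rewrite mxE mulr_ge0 // ltW.
  - by rewrite mxE sumr_ge0 // => i _; rewrite mxE mulr_ge0 // ltW.
  case/andP=> _; rewrite mxE psumr_eq0; last by move=> i _; rewrite mxE mulr_ge0 // ltW.
  move=> /allP /(_ r (mem_index_enum _)) /=; rewrite mxE mulf_eq0 (gt_eqF (NX r)) orbF.
  by move/eqP.
have [[X XP]|[c [c_ge0 c_neq0 cBN]]] := gordan (col_mx (B_S rho) (N_S rho)).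
  exists X => a b ab.
  have [far|near] := boolP ((a, b) \in far_pairs m).
    have := XP (rshift _ (enum_rank_in far (a, b))).
    by rewrite mul_col_mx col_mxEd N_S_mul enum_rankK_in.
  have up k : 0 < (A_row rho (cur k) (next k) *m X) 0 0.
    have := XP (lshift _ (lshift _ k)).
    by rewrite mul_col_mx col_mxEu B_S_mul col_mxEu mxE.
  have dn k : 0 < (A_row rho (next k) (cur k) *m X) 0 0.
    have := XP (lshift _ (rshift _ k)).
    by rewrite mul_col_mx col_mxEu B_S_mul col_mxEd mxE.
  rewrite in_far_pairs in near; rewrite -val_eqE /= in ab.
  have := ltn_ord a; have := ltn_ord b => bm am.
  have [abE|baE] : (b = a.+1 :> nat \/ a = b.+1 :> nat) by lia.
    have am' : (a < m)%N by lia.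
    have -> : a = cur (Ordinal am') by apply: val_inj.
    by have -> : b = next (Ordinal am') by apply: val_inj; rewrite /= abE.
  have bm' : (b < m)%N by lia.
  have -> : b = cur (Ordinal bm') by apply: val_inj.
  by have -> : a = next (Ordinal bm') by apply: val_inj; rewrite /= baE.
case: noY; pose z := lsubmx c; pose y := rsubmx c.
have cE : c = row_mx z y by rewrite hsubmxK.
have zy : z *m B_S rho + y *m N_S rho = 0 by rewrite -mul_row_col -cE.
have zE : z^T = Y_S rho *m y^T.
  rewrite /Y_S mulNmx -mulmxA -trmx_mul -mulmxN -linearN /=.
  have -> : - (y *m N_S rho) = z *m B_S rho by apply/eqP; rewrite eq_sym -addr_eq0 zy.
  by rewrite trmx_mul mulmxA mulVmx // mul1mx.
exists y^T; split=> [i|r|yT0].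
- by rewrite -zE mxE mxE.
- by rewrite mxE mxE.
(* Since [z] is determined by [y], a nonzero certificate has a nonzero [y]. *)
have y0 : y = 0 by apply: trmx_inj; rewrite yT0 trmx0.
have z0 : z = 0 by apply: trmx_inj; rewrite zE yT0 mulmx0 trmx0.
by rewrite cE y0 z0 row_mx0 eqxx in c_neq0.
Qed.

End System.


(** * From drawings to solutions and back *)

Lemma ord_homo_lt (R : realType) (n : nat) (g : 'I_n -> R) :
  (forall i j : 'I_n, j = i.+1 :> nat -> g i < g j) ->
  forall i j : 'I_n, (i < j)%N -> g i < g j.
Proof.
move=> gS i [j jn] /=; elim: j jn => [//|j IHj] jn ij.
have jn' := ltnW jn.
have step : g (Ordinal jn') < g (Ordinal jn) by apply: gS.
move: ij; rewrite ltnS leq_eqVlt => /predU1P[ij|/IHj]; last by move/(_ jn')/lt_trans; apply.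
by have -> : i = Ordinal jn' by apply: val_inj.
Qed.

Section Drawing.
Variables (R : realType) (m : nat) (rho : 'I_m.+1 -> 'I_m.+1 -> R).
Hypotheses (rho_dis : dissimilarity rho) (rho_strict : strict_dissimilarity rho)
  (rho_id : compatible_order rho (fun i j : 'I_m.+1 => (i < j)%N)).

(** The Robinson inequality gives the weak bound and strictness excludes equality; for [i = j] this
    is positivity of [rho]. *)
Lemma rho_lt_outer (i j k : 'I_m.+1) : (i <= j)%N -> (j < k)%N -> rho i j < rho i k.
Proof.
have [rho_ge0 rhoC rho_eq0] := rho_dis; rewrite leq_eqVlt => /predU1P[/val_inj -> jk|ij jk].
  rewrite (rho_eq0 j j).2 // lt_neqAle rho_ge0 andbT eq_sym; apply/eqP => /rho_eq0 jkE.
  by rewrite jkE ltnn in jk.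
have := rho_id.2 _ _ _ ij jk; rewrite ge_max => /andP[le _].
rewrite lt_neqAle le andbT; apply/eqP; apply: rho_strict; last first.
  by left=> ijE; rewrite ijE ltnn in ij.
apply/eqP => /setP /(_ k); rewrite !inE eqxx orbT => /orP[] /eqP kE; move: ij jk; rewrite kE; lia.
Qed.

Lemma rho_gt_inner (i j k : 'I_m.+1) : (i < j)%N -> (j <= k)%N -> rho j k < rho i k.
Proof.
have [rho_ge0 rhoC rho_eq0] := rho_dis; rewrite [(j <= k)%N]leq_eqVlt.
move=> ij /predU1P[/val_inj <-|jk].
  rewrite (rho_eq0 j j).2 // lt_neqAle rho_ge0 andbT eq_sym; apply/eqP => /rho_eq0 ijE.
  by rewrite ijE ltnn in ij.
have := rho_id.2 _ _ _ ij jk; rewrite ge_max => /andP[_ le].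
rewrite lt_neqAle le andbT; apply/eqP; apply: rho_strict; last first.
  by left=> jkE; rewrite jkE ltnn in jk.
apply/eqP => /setP /(_ i); rewrite !inE eqxx /= => /orP[] /eqP iE; move: ij jk; rewrite iE; lia.
Qed.

Lemma drawing_solution : drawable_in_caterpillar rho ->
  exists X : 'cV[R]_(m + m), forall a b, a != b -> 0 < (A_row rho a b *m X) 0 0.
Proof.
have [rho_ge0 rhoC rho_eq0] := rho_dis.
case=> V [e [w [d [/caterpillar_leg_dist[pos [leg dE]] [I [I_inj I_valid]]]]]].
pose D (i j : 'I_m.+1) := d (I i) (I j).
have D_valid x y z : rho x y < rho x z -> D x y < D x z by exact: I_valid.
have DC (i j : 'I_m.+1) : D i j = D j i.
  by rewrite /D !dE /leg_dist eq_sym distrC addrAC.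
have D0 i : D i i = 0 by rewrite /D dE /leg_dist eqxx.
pose u (i : 'I_m.+1) := D ord0 i; pose v (i : 'I_m.+1) := D ord0 ord_max - D i ord_max.
have u_incr (i j : 'I_m.+1) : (i < j)%N -> u i < u j.
  by move=> ij; apply: D_valid; apply: rho_lt_outer.
have v_incr (i j : 'I_m.+1) : (i < j)%N -> v i < v j.
  move=> ij; rewrite /v ltrD2l ltrN2 ![D _ ord_max]DC; apply: D_valid.
  by rewrite ![rho ord_max _]rhoC; apply: rho_gt_inner => //; rewrite -ltnS ltn_ord.
(* If [i] is first or [j] is last this is immediate; otherwise the four points are distinct, and
   monotonicity of [u] and [v] gives the strict inequality that the four-point lemma asks for. *)
have DE (i j : 'I_m.+1) : (i < j)%N -> D i j = u j - v i.
  move=> ij; rewrite /u /v; have [->|i0] := eqVneq i ord0; first by rewrite subrr subr0.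
  have [->|jm] := eqVneq j ord_max; first by rewrite opprB addrC subrK.
  have lt0i : (0 < i)%N by rewrite lt0n.
  have ltjm : (j < m)%N by rewrite ltn_neqAle -ltnS ltn_ord andbT; move: jm; rewrite -val_eqE.
  have uniq4 : uniq [:: I ord0; I i; I j; I ord_max].
    rewrite (map_inj_uniq I_inj [:: _; _; _; _]) /= !inE !negb_or -!val_eqE /=.
    by move: lt0i ij ltjm => /=; lia.
  have := leg_dist_four_point dE uniq4; have := u_incr _ _ ij; have := v_incr _ _ ij.
  rewrite /u /v /D => v_lt u_lt four_point.
  suff : d (I i) (I j) + d (I ord0) (I ord_max) = d (I ord0) (I j) + d (I i) (I ord_max) by lra.
  by apply: four_point; lra.
have [||X [hX lX]] := @exists_hlval R m (fun i => (u i + v i) / 2) (fun i => (u i - v i) / 2).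
- by rewrite /u /v D0; lra.
- by rewrite /u /v D0; lra.
exists X => a b ab; rewrite A_rowE !hX !lX.
case: ifPn => [lt_ab|]; last rewrite -leqNgt => le_ba.
  (* The row equals D(L,b) - D(a,L) when a < L. For L = a the formula [DE] does not apply, and the
     row is u_b - u_a. *)
  have [] := LcenterP rho_dis lt_ab; set L := Lcenter _ _ _.
  rewrite leq_eqVlt => /predU1P[/val_inj <- _ _ _|aL Lb rL _].
    by have := u_incr _ _ lt_ab; lra.
  rewrite [rho a L]rhoC in rL; have := D_valid _ _ _ rL.
  by rewrite [D L a]DC !DE //; lra.
have lt_ba : (b < a)%N by rewrite ltn_neqAle le_ba andbT eq_sym val_eqE.
(* Here [L] is the right center: the row equals D(b,L) - D(L,a), or v_a - v_b when L = a. *)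
have [] := RcenterP rho_dis lt_ba; set L := Rcenter _ _ _.
rewrite [(L <= a)%N]leq_eqVlt => aL /predU1P[/val_inj -> _ _|Lb rL _].
  by have := v_incr _ _ lt_ba; lra.
rewrite [rho b L]rhoC in rL; have := D_valid _ _ _ rL.
by rewrite [D L b]DC !DE //; lra.
Qed.

Lemma solution_drawing (X : 'cV[R]_(m + m)) : (0 < m)%N ->
  (forall a b, a != b -> 0 < (A_row rho a b *m X) 0 0) -> drawable_in_caterpillar rho.
Proof.
move=> m_gt0 XP; have [rho_ge0 rhoC rho_eq0] := rho_dis.
pose h := hval X; pose l := lval X.
have u_incr (i j : 'I_m.+1) : (i < j)%N -> h i + l i < h j + l j.
  apply: (ord_homo_lt (g := fun i => h i + l i)) => {}i {}j ij.
  rewrite -subr_gt0 -(A_row_next rho_dis X ij).1 XP // -val_eqE /= ij; lia.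
have v_incr (i j : 'I_m.+1) : (i < j)%N -> h i - l i < h j - l j.
  apply: (ord_homo_lt (g := fun i => h i - l i)) => {}i {}j ij.
  rewrite -subr_gt0 -(A_row_next rho_dis X ij).2 XP // -val_eqE /= ij; lia.
have h_incr (i j : 'I_m.+1) : (i < j)%N -> h i < h j.
  by move=> ij; have := u_incr _ _ ij; have := v_incr _ _ ij; lra.
have h_homo (i j : 'I_m.+1) : (i <= j)%N -> h i <= h j.
  by rewrite leq_eqVlt => /predU1P[/val_inj ->|/h_incr/ltW].
(* Adding a constant to all leg lengths does not affect the comparisons. *)
pose c := 1 + \sum_i `|l i|.
have l_gt0 i : 0 < l i + c.
  rewrite /c (bigD1 i) //=; have := ler_norm (- l i); rewrite normrN.
  have : 0 <= \sum_(j < m.+1 | j != i) `|l j| by rewrite sumr_ge0.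
  lra.
have [V [e [w [d [I [cat I_inj dE]]]]]] := exists_comb m_gt0 l_gt0 h_incr.
exists V, e, w, d; split=> //; exists I; split=> // x y z.
have dC (i j : 'I_m.+1) : d (I i) (I j) = d (I j) (I i) by rewrite !dE eq_sym distrC addrAC.
have d_lt (i j : 'I_m.+1) : (i < j)%N -> d (I i) (I j) = (h j + l j) - (h i - l i) + 2 * c.
  move=> ij; rewrite dE -val_eqE ltn_eqF // ltr0_norm ?subr_lt0 ?h_incr //; lra.
have d_gt0 (i j : 'I_m.+1) : i != j -> 0 < d (I i) (I j).
  by move=> ij; rewrite dE (negbTE ij) -addrA ltr_wpDl // addr_gt0.
have d0 i : d (I i) (I i) = 0 by rewrite dE eqxx.
have rho0 i : rho i i = 0 by apply/rho_eq0.
have [->|zx] := eqVneq z x; first by rewrite rho0 ltNge rho_ge0.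
have [->|yx] := eqVneq y x; first by rewrite d0 d_gt0 // eq_sym.
(* With [y] and [z] on one side of [x], the Robinson property makes [y] the nearer one in the order,
   and monotonicity of h - l (left) or h + l (right) suffices. Only the two mixed cases use
   centers. *)
move: zx yx; rewrite -!val_eqE !neq_ltn => /orP[zx|xz] /orP[yx|xy] ryz.
- have zy : (z < y)%N.
    rewrite ltnNge leq_eqVlt; apply/negP => /predU1P[/val_inj yz|yz].
      by rewrite yz ltxx in ryz.
    by have := rho_gt_inner yz (ltnW zx); rewrite ltNge [rho z x]rhoC [rho y x]rhoC ltW.
  by rewrite ![d (I x) _]dC !d_lt //; have := v_incr _ _ zy; lra.
(* Here [x] is admissible for R(y,z), so h_R <= h_x; and d(x,z) - d(x,y) is row (y,z) with h_x in
   place of h_R. The next case is the mirror image with L(y,z). *)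
- have zy := ltn_trans zx xy; have [_ _ _ Rmin] := RcenterP rho_dis zy.
  rewrite [rho x z]rhoC in ryz.
  have := h_homo _ _ (Rmin x (introT andP (conj (ltnW zx) (ltnW xy))) ryz).
  have := XP y z; rewrite A_rowE ltnNge (ltnW zy) -/h -/l -val_eqE gtn_eqF // => /(_ isT) /=.
  by rewrite [d (I x) (I z)]dC !d_lt //; lra.
- have yz := ltn_trans yx xz; have [_ _ _ Lmax] := LcenterP rho_dis yz.
  rewrite [rho x y]rhoC in ryz.
  have := h_homo _ _ (Lmax x (introT andP (conj (ltnW yx) (ltnW xz))) ryz).
  have := XP y z; rewrite A_rowE yz -/h -/l -val_eqE ltn_eqF // => /(_ isT) /=.
  by rewrite [d (I x) (I y)]dC !d_lt //; lra.
have yz : (y < z)%N.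
  rewrite ltnNge leq_eqVlt; apply/negP => /predU1P[/val_inj yz|yz].
    by rewrite yz ltxx in ryz.
  by have := rho_lt_outer (ltnW xz) yz; rewrite ltNge ltW.
by rewrite !d_lt //; have := u_incr _ _ yz; lra.
Qed.

End Drawing.

Theorem lemma12 (R : realType) (m : nat) (rho : 'I_m.+1 -> 'I_m.+1 -> R)
    (n_ge2 : (2 <= m.+1)%N)
    (rho_space : strict_robinson_space rho)
    (rho_id : compatible_order rho (fun i j : 'I_m.+1 => (i < j)%N)) :
  drawable_in_caterpillar rho <->
  ~ exists y : 'cV[R]_#|far_pairs m|,
      [/\ forall i, 0 <= (Y_S rho *m y) i 0, forall r, 0 <= y r 0 & y <> 0].
Proof.
have [rho_dis _ rho_strict] := rho_space.
rewrite -(A_row_alternative rho_dis); split; first exact: drawing_solution.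
by case=> X; apply: solution_drawing.
Qed.
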